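(* Let $l=9$, $r\in\{1,2,4\}$ and $a=[r]$. Then $p_{4,2}(1/a)$, $p_{8,3}(1/a)$, $p_{8,5}(1/a)$, $p_{16,4}(1/a)$ and $p_{16,8}(1/a)$ are in $S$.
   Context: For an integer $i$, $[i]=\sum x^{n^2}\in\mathbb{Z}/2[[x]]$, summed over $n\in\mathbb{Z}$ with $n\equiv i\pmod 9$. $S$ is the subring of $\mathbb{Z}/2[[x]]$ generated over $\mathbb{Z}/2$ by $[1],[2],[3],[4]$. $1/a$ is taken in the field $L$ of Laurent series over $\mathbb{Z}/2$. For $q$ a power of $2$ and $0\le j<q$, $p_{q,j}:L\to L$ is $\sum_n c_nx^n\mapsto\sum_{n\equiv j\pmod q}c_nx^n$. *)

(* Defs.v *)
From HB Require Import structures.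
From mathcomp Require Import all_boot all_order all_algebra.
From mathcomp Require Import boolp classical_sets functions cardinality fsbigop.
From mathcomp Require Import zify.
Set Implicit Arguments.
Unset Strict Implicit.
Unset Printing Implicit Defensive.
Import Order.TTheory GRing.Theory Num.Theory.
Local Open Scope classical_set_scope.
Local Open Scope ring_scope.

(* [laurent F] is the field F((x)); [f n] is the coefficient of x^n in f. *)
Record laurent (F : fieldType) := Laurent {
  lcoef :> int -> F;
  lcoef_bounded : exists a : int, forall n, n < a -> lcoef n = 0 }.

HB.instance Definition _ (F : fieldType) := gen_eqMixin (laurent F).
HB.instance Definition _ (F : fieldType) := gen_choiceMixin (laurent F).

Section LaurentField.
Variable F : fieldType.
Implicit Types (f g h : laurent F) (a b c n : int) (m N : nat).

Lemma laurentP f g : (forall n, f n = g n) -> f = g.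
Proof.
case: f g => [f fb] [g gb] /= /funext fg; rewrite {}fg in fb *.
by congr Laurent; exact: Prop_irrelevance.
Qed.

Definition vanishes_below a (u : int -> F) := forall n, n < a -> u n = 0.

Fact lzero_bounded : exists a, vanishes_below a (fun=> 0).
Proof. by exists 0. Qed.
Definition lzero := Laurent lzero_bounded.

Fact lone_bounded : exists a, vanishes_below a (fun n => (n == 0)%:R).
Proof. by exists 0 => n n0; rewrite lt_eqF. Qed.
Definition lone := Laurent lone_bounded.

Fact lopp_bounded f : exists a, vanishes_below a (fun n => - f n).
Proof. by have [a fa] := lcoef_bounded f; exists a => n /fa ->; rewrite oppr0. Qed.
Definition lopp f := Laurent (lopp_bounded f).

Fact ladd_bounded f g : exists a, vanishes_below a (fun n => f n + g n).
Proof.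
have [[a fa] [b gb]] := (lcoef_bounded f, lcoef_bounded g).
exists (Num.min a b) => n; rewrite lt_min => /andP[na nb].
by rewrite fa ?gb ?addr0.
Qed.
Definition ladd f g := Laurent (ladd_bounded f g).

(* The family summed here has finite support. *)
Definition lmul_coef f g n : F := \sum_(i \in [set: int]) (f i * g (n - i)).

Definition trunc (u : int -> F) a N : {poly F} :=
  \poly_(k < N) u (a + k%:Z).

Lemma lmul_coefE f g a b m N :
  vanishes_below a f -> vanishes_below b g -> (m < N)%N ->
  lmul_coef f g (a + b + m%:Z) = (trunc f a N * trunc g b N)`_m.
Proof.
move=> fa gb mN; rewrite coefM /lmul_coef.
have injm : injective (fun k : nat => a + k%:Z) by move=> k l; lia.
pose s := [seq a + k%:Z | k <- index_iota 0 m.+1].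
rewrite -(fsbig_widen [set` s]) //; last first.
  move=> i [_ Ni]; apply/eqP; rewrite mulf_eq0.
  have [/fa -> |ai] := ltP i a; first by rewrite eqxx.
  rewrite [g _]gb ?eqxx ?orbT // ltNge; apply/negP => le_b; apply: Ni => /=.
  apply/mapP; exists (absz (i - a)); last by lia.
  by rewrite mem_index_iota; lia.
rewrite -fsbig_seq ?map_inj_uniq ?iota_uniq // big_map big_mkord.
apply: eq_bigr => k _; have := ltn_ord k => km.
rewrite !coef_poly !ifT; [|by lia|by lia].
by congr (_ * g _); lia.
Qed.

Lemma lmul_vanishes f g a b : vanishes_below a f -> vanishes_below b g ->
  vanishes_below (a + b) (lmul_coef f g).
Proof.
move=> fa gb n nab; rewrite /lmul_coef fsbig1 // => i _.
have [/fa ->|ai] := ltP i a; first by rewrite mul0r.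
by rewrite [g _]gb ?mulr0 //; lia.
Qed.

Fact lmul_bounded f g : exists a, vanishes_below a (lmul_coef f g).
Proof.
have [[a fa] [b gb]] := (lcoef_bounded f, lcoef_bounded g).
by exists (a + b); apply: lmul_vanishes.
Qed.
Definition lmul f g := Laurent (lmul_bounded f g).

Lemma coefM_eq N (p p' q q' : {poly F}) :
  (forall m, (m < N)%N -> p`_m = p'`_m) ->
  (forall m, (m < N)%N -> q`_m = q'`_m) ->
  forall m, (m < N)%N -> (p * q)`_m = (p' * q')`_m.
Proof.
move=> pp' qq' m mN; rewrite !coefM; apply: eq_bigr => k _.
by have := ltn_ord k => km; rewrite pp' ?qq' //; lia.
Qed.

Lemma trunc_lmul f g a b N m :
  vanishes_below a f -> vanishes_below b g -> (m < N)%N ->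
  (trunc (lmul f g) (a + b) N)`_m = (trunc f a N * trunc g b N)`_m.
Proof. by move=> fa gb mN; rewrite coef_poly mN /= (@lmul_coefE f g a b m N). Qed.

Lemma eq_from a f g : vanishes_below a f -> vanishes_below a g ->
  (forall m, f (a + m%:Z) = g (a + m%:Z)) -> f = g.
Proof.
move=> fa ga fg; apply: laurentP => n.
have [na|an] := ltP n a; first by rewrite fa ?ga.
by have -> : n = a + (absz (n - a))%:Z by lia.
Qed.

Lemma laddA : associative ladd.
Proof. by move=> f g h; apply: laurentP => n /=; rewrite addrA. Qed.
Lemma laddC : commutative ladd.
Proof. by move=> f g; apply: laurentP => n /=; rewrite addrC. Qed.
Lemma ladd0 : left_id lzero ladd.
Proof. by move=> f; apply: laurentP => n /=; rewrite add0r. Qed.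
Lemma laddN : left_inverse lzero lopp ladd.
Proof. by move=> f; apply: laurentP => n /=; rewrite addNr. Qed.

Lemma lmulA : associative lmul.
Proof.
move=> f g h.
have [[a fa] [b gb]] := (lcoef_bounded f, lcoef_bounded g).
have [c hc] := lcoef_bounded h.
have fg := lmul_vanishes fa gb; have gh := lmul_vanishes gb hc.
apply: (@eq_from (a + (b + c))) => [||m].
- exact: lmul_vanishes.
- by rewrite addrA; apply: lmul_vanishes.
rewrite [LHS](@lmul_coefE f (lmul g h) a (b + c) m m.+1) //.
rewrite addrA [RHS](@lmul_coefE (lmul f g) h (a + b) c m m.+1) //.
rewrite (@coefM_eq m.+1 _ (trunc f a m.+1) _
   (trunc g b m.+1 * trunc h c m.+1)) //; last first.
  by move=> k km; apply: trunc_lmul.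
rewrite mulrA; apply/esym; apply: (@coefM_eq m.+1) => // k km.
exact: trunc_lmul.
Qed.

Lemma lmulC : commutative lmul.
Proof.
move=> f g; have [[a fa] [b gb]] := (lcoef_bounded f, lcoef_bounded g).
apply: (@eq_from (a + b)) => [||m].
- exact: lmul_vanishes.
- by rewrite addrC; apply: lmul_vanishes.
rewrite [LHS](@lmul_coefE f g a b m m.+1) // mulrC.
by rewrite [a + b]addrC [RHS](@lmul_coefE g f b a m m.+1).
Qed.

Lemma lone_vanishes : vanishes_below 0 lone.
Proof. by move=> n n0; rewrite /= lt_eqF. Qed.

Lemma lmul1 : left_id lone lmul.
Proof.
move=> f; have [a fa] := lcoef_bounded f.
apply: (@eq_from a) => // [|m].
  by rewrite -[a]add0r; apply: lmul_vanishes => //; apply: lone_vanishes.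
rewrite -{1}[a]add0r [LHS](@lmul_coefE lone f 0 a m m.+1) //; last first.
  exact: lone_vanishes.
rewrite (@coefM_eq m.+1 _ 1 _ (trunc f a m.+1)) //; last first.
  by move=> k km; rewrite coef_poly km coef1 add0r.
by rewrite mul1r coef_poly ltnSn.
Qed.

Lemma lmulDl : left_distributive lmul ladd.
Proof.
move=> f g h.
have [[a0 fa0] [b0 gb0]] := (lcoef_bounded f, lcoef_bounded g).
have [c hc] := lcoef_bounded h; pose a := Num.min a0 b0.
have fa : vanishes_below a f by move=> n; rewrite lt_min => /andP[/fa0].
have ga : vanishes_below a g by move=> n; rewrite lt_min => /andP[_ /gb0].
have fga : vanishes_below a (ladd f g).
  by move=> n na /=; rewrite fa ?ga ?addr0.
apply: (@eq_from (a + c)) => [||m].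
- exact: lmul_vanishes.
- by move=> n na /=; rewrite !(lmul_vanishes _ hc na) ?addr0.
rewrite [LHS](@lmul_coefE (ladd f g) h a c m m.+1) //=.
rewrite (@lmul_coefE f h a c m m.+1) // (@lmul_coefE g h a c m m.+1) //.
rewrite -coefD -mulrDl; apply: (@coefM_eq m.+1) => // k km.
by rewrite coefD !coef_poly km.
Qed.

Lemma lone_neq0 : lone != lzero.
Proof.
apply/eqP => /(congr1 (fun f : laurent F => f 0)) /= /eqP.
by rewrite oner_eq0.
Qed.

HB.instance Definition _ := GRing.isZmodule.Build (laurent F)
  laddA laddC ladd0 laddN.
HB.instance Definition _ := GRing.Zmodule_isComNzRing.Build (laurent F)
  lmulA lmulC lmul1 lmulDl lone_neq0.

Lemma lcoef0 n : (0 : laurent F) n = 0. Proof. by []. Qed.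
Lemma lcoef1 n : (1 : laurent F) n = (n == 0)%:R. Proof. by []. Qed.
Lemma lcoefD f g n : (f + g) n = f n + g n. Proof. by []. Qed.
Lemma lcoefN f n : (- f) n = - f n. Proof. by []. Qed.
Lemma lcoefM f g n : (f * g) n = \sum_(i \in [set: int]) (f i * g (n - i)).
Proof. by []. Qed.

Lemma laurent_order f : f != 0 ->
  exists a, vanishes_below a f /\ f a != 0.
Proof.
move=> f0; have [a fa] := lcoef_bounded f.
have [m fm] : exists m : nat, f (a + m%:Z) != 0.
  apply: contrapT => Nf; move/eqP: f0; apply.
  apply: (@eq_from a) => // m; rewrite lcoef0; apply/eqP.
  by apply: contrapT => /negP fm; apply: Nf; exists m.
have exm : exists m : nat, f (a + m%:Z) != 0 by exists m.
case: (ex_minnP exm) => {fm} {}m fm minm; exists (a + m%:Z); split => // n nm.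
have [/fa //|an] := ltP n a; apply/eqP/negPn/negP => fn.
have := minm (absz (n - a)); have -> : a + (absz (n - a))%:Z = n by lia.
by move=> /(_ fn); lia.
Qed.

(* The first N coefficients of the inverse of the power series u. *)
Fixpoint inv_seq (u : nat -> F) N : seq F :=
  if N is N'.+1 then
    let s := inv_seq u N' in
    rcons s (((N' == 0)%:R - \sum_(k < N') s`_k * u (N' - k)%N) / u 0%N)
  else [::].

Lemma size_inv_seq u N : size (inv_seq u N) = N.
Proof. by elim: N => //= N IH; rewrite size_rcons IH. Qed.

Lemma inv_seqE u N m : (m < N)%N -> (inv_seq u N)`_m = (inv_seq u m.+1)`_m.
Proof.
elim: N => // N IH; rewrite ltnS leq_eqVlt => /predU1P[-> //|mN].
by rewrite [LHS]nth_rcons size_inv_seq mN IH.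
Qed.

Lemma inv_seqP u m : u 0%N != 0 ->
  \sum_(k < m.+1) (inv_seq u k.+1)`_k * u (m - k)%N = (m == 0)%:R.
Proof.
move=> u0; rewrite big_ord_recr /= subnn nth_rcons size_inv_seq ltnn eqxx.
rewrite divfK // addrC -[RHS]subr0 -addrA; congr (_ + _).
rewrite oppr0; apply/eqP; rewrite addrC subr_eq0; apply/eqP.
by apply: eq_bigr => k _; rewrite (inv_seqE u (ltn_ord k)).
Qed.

Lemma laurent_inv_exists f : f != 0 -> exists g, g * f = 1.
Proof.
move=> /laurent_order[a [fa fa0]].
pose u k := f (a + k%:Z).
pose w n : F := if 0 <= n + a then (inv_seq u (absz (n + a)).+1)`_(absz (n + a)) else 0.
have wb : vanishes_below (- a) w by move=> n na; rewrite /w ifF //; lia.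
have wB : exists b, vanishes_below b w by exists (- a).
exists (Laurent wB); apply: (@eq_from 0) => [||m].
- by rewrite -(addNr a); apply: lmul_vanishes.
- exact: lone_vanishes.
rewrite -{1}(addNr a).
rewrite [LHS](@lmul_coefE (Laurent wB) f (- a) a m m.+1) // coefM.
rewrite add0r lcoef1 -[(m%:Z == 0)]/(m == 0%N) -(@inv_seqP u m) /u ?addr0 //.
apply: eq_bigr => k _; have km := ltn_ord k.
rewrite !coef_poly km ifT; last by lia.
congr (_ * _); rewrite /= /w ifT; last by lia.
by have -> : absz (- a + k%:Z + a) = k by lia.
Qed.

Definition linv f : laurent F :=
  if pselect (exists g, g * f = 1) is left e then projT1 (cid e) else 0.

Lemma lmulV f : f != 0 -> linv f * f = 1.
Proof.
move=> /laurent_inv_exists ex; rewrite /linv.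
by case: pselect => // e; case: (cid e).
Qed.

Lemma linv0 : linv 0 = 0.
Proof.
rewrite /linv; case: pselect => // e; case: (cid e) => g /=.
by rewrite mulr0 => /esym/eqP; rewrite oner_eq0.
Qed.

HB.instance Definition _ := GRing.ComNzRing_isField.Build (laurent F)
  lmulV linv0.

(* F[[x]], as a subset of F((x)). *)
Definition power_series : set (laurent F) :=
  [set f : laurent F | vanishes_below 0 f].

Lemma power_series_subring : subring_closed (mem power_series).
Proof.
split=> [|f g|f g]; rewrite ?inE.
- exact: lone_vanishes.
- by move=> f0 g0 n n0; rewrite lcoefD lcoefN f0 ?g0 ?subr0.
- by move=> f0 g0 n n0; apply: (lmul_vanishes f0 g0); rewrite addr0.
Qed.

(* p_{q,j}: keep only the exponents congruent to j mod q. *)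
Fact lproj_bounded (q j : nat) f :
  exists a, vanishes_below a (fun n => if (n == j %[mod q])%Z then f n else 0).
Proof.
have [a fa] := lcoef_bounded f.
by exists a => n /fa ->; rewrite if_same.
Qed.
Definition lproj (q j : nat) f := Laurent (lproj_bounded q j f).

Definition subring_gen (G : set (laurent F)) : set (laurent F) :=
  smallest (fun A : set (laurent F) => subring_closed (mem A)) G.

End LaurentField.

(* [i] : the coefficient of x^m in the sum of the x^(n^2), n = i mod 9, is the
   number (mod 2) of such n with n^2 = m; the index set below has at most two
   elements, so that this sum is a genuine finite one. *)
Fact theta_bounded (i : int) : exists a : int, vanishes_below a
  (fun m => \sum_(n \in [set n : int | (n = i %[mod 9])%Z /\ n ^+ 2 = m])
              (1 : 'F_2)).
Proof.
exists 0 => m m0; rewrite fsbig1 // => n [_ nm].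
by move: m0; rewrite -nm ltNge sqr_ge0.
Qed.
Definition theta (i : int) : laurent 'F_2 := Laurent (theta_bounded i).

Lemma theta_neq0 (i : int) : i \in [:: 1; 2; 4] -> theta i != 0.
Proof.
move=> i124; apply/eqP => /(congr1 (fun f : laurent 'F_2 => f (i ^+ 2))) /=.
rewrite [X in fsbigop.finite_support _ X](_ : _ = [set i]).
  by rewrite fsbig_set1 => /eqP; rewrite oner_eq0.
apply/seteqP; split=> n /= => [[nE /eqP]|-> //].
rewrite eqf_sqr => /orP[/eqP //|/eqP nN]; move: nE; rewrite nN.
by move: i124; rewrite !inE => /or3P[] /eqP ->.
Qed.

(* The subring S of F_2[[x]] generated by [1], [2], [3], [4], taken inside
   F_2((x)). *)
Definition theta_ring : set (laurent 'F_2) :=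
  subring_gen [set theta 1; theta 2; theta 3; theta 4].

Lemma theta_ring_power_series : theta_ring `<=` @power_series 'F_2.
Proof.
apply: smallest_sub; first exact: power_series_subring.
have thetaP i : power_series (theta i).
  move=> m m0 /=; rewrite fsbig1 // => n [_ nm].
  by move: m0; rewrite -nm ltNge sqr_ge0.
by move=> f [[[]|]|] ->.
Qed.

(* Main.v *)
Require Import Defs.
From Stdlib Require Import BinNat Ring_theory Ring.
From mathcomp Require Import all_boot all_order all_algebra.
From mathcomp Require Import boolp classical_sets functions cardinality fsbigop.
Import Order.TTheory GRing.Theory Num.Theory.

(** Let [r] be 1, 2 or 4, [k = 7 r], and write [a = [4k]], [b = [2k]],
   [c = [k]], [d = [3k]], so that [a = [r]], [8k = -k] and [d = [3]] modulo 9.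
   Splitting [2i] by the parity of the summation index gives
   [2i] = [i]^4 + o_i, where all exponents of o_i are 1 mod 8, and the change of
   variables (x, y) = (u + v, u - v) in x^2 + y^2 gives
   o_i o_j + [i]^4 [j]^4 = ([i+j] [i-j])^2.  This yields six polynomial relations
   between a, b, c, d.  They also hold on the lines a = b = c = 0 and d = 1,
   (a, b, c) = (x, zx, z^2 x) with z^3 = 1; since a, c and 1 + d are nonzero, they
   imply the further relation a^2 b + b^2 c + c^2 a = d + d^2 + d^3.

   Put o = a + b^4 and o' = b + c^4.  From 1/a = a^3 (1/a)^4 and
   p_{4q,4j}(f^4) = p_{q,j}(f)^4, the five series of the theorem are explicit
   rational functions of a, b, c, for instance p_{4,2}(1/a) = (b^2 o / a^2)^2 and
   p_{16,4j}(1/a) = p_{4,j}(b^3/a)^4.  All of them are polynomials in a, b, c and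
   the three quotients b^5/a, b^2 o/a^2 and
   (a^2 b^2 + a^2 c^8 + a b^5 c^4 + b^10)/a^3, which the relations turn into
   polynomials in a, b, c, d. *)

(** * Polynomial identities in characteristic two *)

(* Taking [id] as the opposite of [T_ring] forces characteristic 2; with [bool]
   as the coefficient ring, [ring] then computes modulo 2. *)
Section CharTwo.
Variables (T : Type) (zero one : T) (add mul : T -> T -> T).
Hypothesis T_ring : ring_theory zero one add mul add id eq.
(** This form of the power is convertible with [x ^+ n], so the identities below apply directly to
    [laurent 'F_2]. *)
Let pow (x : T) (n : nat) := iterop n mul x one.
Local Notation "0" := zero.
Local Notation "1" := one.
Local Notation "x + y" := (add x y).
Local Notation "x * y" := (mul x y).
Local Notation "x ^ n" := (pow x n).

Let of_bool (b : bool) := if b then 1 else 0.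
Let of_bool_morph :
  ring_morph 0 1 add mul add id eq false true addb andb addb id eqb of_bool.
Proof.
have [add0x _ _ mul1x mulC _ mulD _ addxx] := T_ring.
have mul0x x : 0 * x = 0 by rewrite -(addxx 0) mulD addxx.
have addC x y : x + y = y + x by case: T_ring.
by split=> //= [] [] // [] //=; rewrite ?add0x ?mul1x ?mul0x ?addxx //
  addC add0x.
Qed.
Let pow_theory : power_theory 1 mul eq nat_of_bin pow.
Proof.
have mulC x y : x * y = y * x by case: T_ring.
have mulA x y z : x * (y * z) = x * y * z by case: T_ring.
have mul1x x : 1 * x = x by case: T_ring.
have powS x n : pow x n.+1 = x * pow x n.
  by case: n => //=; rewrite mulC mul1x.
have powD x m n : pow x (m + n)%N = pow x m * pow x n.
  by elim: m => [|m IH]; [exact/esym/mul1x | rewrite addSn !powS IH mulA].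
split=> x [//|p].
rewrite -[RHS]/(pow_pos mul x p) -[nat_of_bin _]/(nat_of_pos p).
elim: p => // p IH; cbn [nat_of_pos pow_pos];
  rewrite NatTrec.doubleE -addnn -IH.
  by rewrite powS powD.
by rewrite powD.
Qed.
Ltac bool_const t :=
  match t with
  | zero => constr:(false)
  | one => constr:(true)
  | _ => constr:(InitialRing.NotConstant)
  end.
Ltac nat_const t :=
  match isnatcst t with
  | true => constr:(N.of_nat t)
  | _ => constr:(InitialRing.NotConstant)
  end.
Add Ring char_two_ring : T_ring
  (morphism of_bool_morph, constants [bool_const],
   power_tac pow_theory [nat_const]).

(* The cofactors below were found by linear algebra over F_2. *)
Definition dbl_rel x y z w := x * y + x * z ^ 4 + y ^ 5 + z ^ 2 * w ^ 2.
Definition three_rel x y z w := z * w + z * w ^ 4 + x ^ 4 * w + y ^ 2 * z ^ 2.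
Definition cubic_rel x y z w :=
  x ^ 2 * y + y ^ 2 * z + z ^ 2 * x + w + w ^ 2 + w ^ 3.

Variables a b c d : T.
Hypotheses (abc : dbl_rel a b c d = 0) (bca : dbl_rel b c a d = 0)
  (cab : dbl_rel c a b d = 0).
Hypotheses (abc3 : three_rel a b c d = 0) (bca3 : three_rel b c a d = 0)
  (cab3 : three_rel c a b d = 0).

(** A certificate in the ideal of the relations. The factor [a ^ 2 * c ^ 2 * (1 + d)] vanishes on
    the extra lines of common zeros, where the cubic need not vanish; it is cancelled once [a], [c]
    and [1 + d] are known to be nonzero. *)
Lemma cubic_rel_multiple : a ^ 2 * c ^ 2 * (1 + d) * cubic_rel a b c d = 0.
Proof.
transitivity
  ((a ^ 2 * d + b * c * d ^ 2) * dbl_rel a b c d +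
   (c ^ 2 * d + a * b * d ^ 2) * dbl_rel b c a d +
   a * b ^ 2 * d * three_rel a b c d +
   (a * c ^ 2 + a ^ 2 * b + b ^ 2 * c * d) * three_rel b c a d +
   c ^ 3 * three_rel c a b d).
  rewrite /dbl_rel /three_rel /cubic_rel; ring.
rewrite abc bca abc3 bca3 cab3; ring.
Qed.

Hypothesis abc0 : cubic_rel a b c d = 0.
Variable g : T.
Hypothesis ag : a * g = 1.

(** The numerator is [b ^ 2 * (a + b ^ 4)]. Modulo the relations it equals [q * a ^ 2], and
    multiplying by [g ^ 2] leaves [q]. The next two lemmas follow the same pattern with [a] and
    [a ^ 3]. *)
Lemma quotient2E : (a * b ^ 2 + b ^ 6) * g ^ 2 =
  c + c * d + c * d ^ 3 + b ^ 2 * c ^ 2 + a * c ^ 3 + a ^ 4.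
Proof.
set q := RHS.
have -> : a * b ^ 2 + b ^ 6 = q * a ^ 2 +
  ((b + b * d) * dbl_rel a b c d +
   c * d * dbl_rel b c a d +
   (a + a * d) * dbl_rel c a b d +
   (b * c + a ^ 2) * three_rel a b c d +
   (b ^ 2 + a * c) * three_rel b c a d +
   (c ^ 2 + a * b) * three_rel c a b d +
   (b * c ^ 2 + a * b ^ 2) * cubic_rel a b c d).
  rewrite /q /dbl_rel /three_rel /cubic_rel; ring.
rewrite abc bca cab abc3 bca3 cab3 abc0; ring [ag].
Qed.

Lemma quotient1E : b ^ 5 * g =
  b + b * d ^ 3 + c ^ 4 * d + b ^ 3 * c * d + a ^ 3 * c * d.
Proof.
set q := RHS.
have -> : b ^ 5 = q * a +
  ((1 + d + d ^ 2) * dbl_rel a b c d +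
   c * three_rel a b c d +
   (b + b * d) * three_rel b c a d +
   a * d * three_rel c a b d +
   (c ^ 2 + a * b * d) * cubic_rel a b c d).
  rewrite /q /dbl_rel /three_rel /cubic_rel; ring.
rewrite abc abc3 bca3 cab3 abc0; ring [ag].
Qed.

Lemma quotient3E :
  (a ^ 2 * b ^ 2 + a ^ 2 * c ^ 8 + a * b ^ 5 * c ^ 4 + b ^ 10) * g ^ 3 =
  c + c * d + b ^ 2 * c ^ 2 + a * c ^ 3 + a * b ^ 3 + a ^ 4 +
  b ^ 2 * c ^ 2 * d ^ 2 + c * d ^ 6 + b * c ^ 6 + b ^ 4 * c ^ 3 + b ^ 7 +
  a * c ^ 3 * d ^ 3.
Proof.
set q := RHS.
have -> : a ^ 2 * b ^ 2 + a ^ 2 * c ^ 8 + a * b ^ 5 * c ^ 4 + b ^ 10 =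
  q * a ^ 3 +
  ((a * b + c ^ 2 * d + a * b * d + c ^ 2 * d ^ 2 + a * b * d ^ 2 +
    c ^ 2 * d ^ 3 + b ^ 5 + a * c ^ 4 + a * b * d ^ 3 + a * b ^ 3 * c +
    a ^ 2 * b * c ^ 2) * dbl_rel a b c d +
   (b ^ 2 * d ^ 2 + b ^ 2 * d ^ 3) * dbl_rel b c a d +
   (a ^ 2 + a ^ 2 * d + b * c * d ^ 2 + a ^ 2 * d ^ 3) * dbl_rel c a b d +
   (a ^ 3 + b ^ 3 * d + a * b * c * d + c ^ 3 * d ^ 2 + b ^ 3 * d ^ 2 +
    a ^ 3 * d ^ 2) * three_rel a b c d +
   a ^ 2 * c * three_rel b c a d +
   (a * c ^ 2 + a ^ 2 * b) * three_rel c a b d +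
   (c ^ 4 * d ^ 3 + b ^ 3 * c * d ^ 3 + a * b ^ 3 * c ^ 3 + a * b ^ 6) *
     cubic_rel a b c d).
  rewrite /q /dbl_rel /three_rel /cubic_rel; ring.
rewrite abc bca cab abc3 bca3 cab3 abc0; ring [ag].
Qed.

Let o := a + b ^ 4.
Let o' := b + c ^ 4.
Let u := (a * b ^ 2 + b ^ 6) * g ^ 2.
(** With denominators cleared, [v * a ^ 4 = b ^ 8 * c ^ 8 * o + b ^ 12 * c ^ 4 * o' + o ^ 3 * o' ^
    2]. Splitting off a multiple of [u ^ 2] frees a factor [a], which leaves the numerator of
    [quotient3E] over [a ^ 3]. *)
Let v :=
  (a ^ 2 * b ^ 2 + a ^ 2 * c ^ 8 + a * b ^ 5 * c ^ 4 + b ^ 10) * g ^ 3 +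
  u ^ 2 * (b ^ 2 + b * c ^ 4 + c ^ 8).

(** The numerator collects the terms of [(c ^ 4 + o') ^ 3 * (b ^ 4 + o) ^ 3] in which the exponents
    of [o'] and [o] add up to 1 modulo 4. The last term gives [u ^ 2 * o' ^ 3]; the other three
    share [c ^ 4] and give [c ^ 4 * v]. *)
Lemma quotient4_1E :
  (c ^ 12 * o * b ^ 8 + o' * c ^ 8 * b ^ 12 + o' ^ 2 * c ^ 4 * o ^ 3 +
   o' ^ 3 * o ^ 2 * b ^ 4) * g ^ 4 = c ^ 4 * v + u ^ 2 * o' ^ 3.
Proof. rewrite /v /u /o /o'; ring [ag]. Qed.

(** Now the exponents of [o'] and [o] add up to 2 modulo 4. The first term gives [c ^ 12 * u ^ 2];
    the other three share [o']. *)
Lemma quotient4_2E :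
  (c ^ 12 * o ^ 2 * b ^ 4 + o' * c ^ 8 * o * b ^ 8 +
   o' ^ 2 * c ^ 4 * b ^ 12 + o' ^ 3 * o ^ 3) * g ^ 4 =
  o' * v + c ^ 12 * u ^ 2.
Proof. rewrite /v /u /o /o'; ring [ag]. Qed.
End CharTwo.

From mathcomp Require Import zify ring.
Local Open Scope classical_set_scope.
Local Open Scope ring_scope.

(** * Products of series with square exponents *)

Lemma F2_addxx (x : 'F_2) : x + x = 0.
Proof. exact/addrr_pchar2/pchar_Fp. Qed.

Lemma laurentF2_addxx (f : laurent 'F_2) : f + f = 0.
Proof. by apply: laurentP => n; rewrite lcoefD F2_addxx. Qed.

Lemma laurentF2_oppr (f : laurent 'F_2) : - f = f.
Proof. by apply/eqP; rewrite eq_sym -subr_eq0 opprK laurentF2_addxx. Qed.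

(** Frobenius is additive in characteristic 2 and fixes ['F_2], so squaring substitutes ['X^2] for
    ['X]. *)
Lemma coef_sqr_F2 (p : {poly 'F_2}) k :
  (p ^+ 2)`_k = if odd k then 0 else p`_k./2.
Proof.
have ch : 2 \in [pchar {poly 'F_2}] by rewrite pchar_poly pchar_Fp.
have -> : p ^+ 2 = \sum_(i < size p) p`_i *: 'X^(2 * i).
  rewrite -[p in LHS]coefK poly_def -(pFrobenius_autE ch) rmorph_sum /=.
  apply: eq_bigr => i _; rewrite pFrobenius_autE exprZn -exprM mulnC.
  by congr (_ *: _); case: p`_i => [[|[|]]] //= ?; apply/val_inj.
rewrite coef_sum; under eq_bigr do rewrite coefZ coefXn.
case: ifPn => [ok|ek].
  rewrite big1 // => i _; rewrite [k == _](_ : _ = false) ?mulr0 //; lia.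
have [ks|sk] := ltnP k./2 (size p).
  rewrite (bigD1 (Ordinal ks)) //= big1 ?addr0 => [|i /eqP ni].
    by rewrite (_ : k == _) ?mulr1 //; lia.
  rewrite [k == _](_ : _ = false) ?mulr0 //.
  by apply/negP => /eqP ki; apply: ni; apply/val_inj => /=; lia.
rewrite nth_default // big1 // => i _.
by rewrite [k == _](_ : _ = false) ?mulr0 //; have := ltn_ord i; lia.
Qed.

Lemma lcoef_sqr (f : laurent 'F_2) n :
  (f ^+ 2) n = if (2 %| n)%Z then f (n %/ 2)%Z else 0.
Proof.
have [a fa] := lcoef_bounded f.
have [na|an] := ltP n (a + a).
  rewrite expr2 [LHS](lmul_vanishes fa fa na); case: ifP => // _.
  by rewrite fa //; lia.
have {an}[k ->] : exists k : nat, n = a + a + k%:Z.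
  by exists (absz (n - (a + a))%R); lia.
rewrite expr2 [LHS](@lmul_coefE _ f f a a k k.+1) // -expr2 coef_sqr_F2.
case: ifPn => ok; first by rewrite ifF //; lia.
by rewrite ifT ?coef_poly ?ifT; [congr (f _)| |]; lia.
Qed.

(** An arbitrary predicate in place of the congruence of [theta] allows parity conditions to be
    added. *)
Fact square_series_bounded (A : pred int) : exists a, vanishes_below a
  (fun m => \sum_(n \in [set n : int | A n && (n ^+ 2 == m)]) (1 : 'F_2)).
Proof.
exists 0 => m m0; rewrite fsbig1 // => n /andP[_ /eqP nm].
by move: m0; rewrite -nm ltNge sqr_ge0.
Qed.
Definition square_series A := Laurent (square_series_bounded A).

Lemma square_seriesE A m : square_series A m =
  \sum_(n \in [set n : int | A n && (n ^+ 2 == m)]) (1 : 'F_2).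
Proof. by []. Qed.

Lemma thetaE i : theta i = square_series (fun n => n == i %[mod 9])%Z.
Proof.
apply: laurentP => m; apply: eq_fsbigl; apply/seteqP; split=> n /=.
  by move=> [/eqP -> /eqP ->].
by move=> /andP[/eqP ? /eqP].
Qed.

Definition box (K : nat) : seq int := [seq k%:Z - K%:Z | k <- iota 0 K.*2.+1].

Lemma box_uniq K : uniq (box K).
Proof. by rewrite map_inj_uniq ?iota_uniq // => k l; lia. Qed.

Lemma mem_box K (x : int) : (absz x <= K)%N -> x \in box K.
Proof.
move=> xK; apply/mapP; exists (absz (x + K%:Z)%R); last by lia.
by rewrite mem_iota; lia.
Qed.

Lemma mem_box_sqr K (x : int) : x ^+ 2 <= K%:Z -> x \in box K.
Proof. by move=> xK; apply: mem_box; nia. Qed.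

(** Indices outside [box K] have squares above [K], so up to degree [K] the series is a
    polynomial. *)
Lemma square_series_coef A K (m : nat) : (m <= K)%N ->
  square_series A m = (\sum_(x <- box K | A x) 'X^(absz x ^ 2))`_m.
Proof.
move=> mK; rewrite square_seriesE coef_sum.
rewrite [RHS](eq_bigr (fun x => if m == (absz x ^ 2)%N then 1 else 0));
  last first.
  by move=> x _; rewrite coefXn; case: eqP.
rewrite -big_mkcondr /= [RHS]bigfs ?box_uniq // => [|x].
  apply: eq_fsbigl; apply/seteqP; split=> n /= /andP[An /eqP nm];
    by apply/andP; split=> //; apply/eqP; move: nm; lia.
by move=> /andP[_ /eqP xm]; rewrite mem_box_sqr //; lia.
Qed.

(** Truncation at degree [m] reduces this to a product of two polynomials summed over [box m], which
    expands over pairs of indices. *)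
Lemma square_seriesM A B (m : int) : (square_series A * square_series B) m =
  \sum_(p \in [set p : int * int |
    [&& A p.1, B p.2 & p.1 ^+ 2 + p.2 ^+ 2 == m]]) (1 : 'F_2).
Proof.
have [A0 B0] : vanishes_below 0 (square_series A) /\
    vanishes_below 0 (square_series B).
  by split=> k k0 /=; rewrite fsbig1 // => n /andP[_ /eqP nm]; nia.
case: m => m; last first.
  rewrite [LHS](lmul_vanishes A0 B0) // fsbig1 // => p /and3P[_ _ /eqP]; nia.
rewrite -[LHS]/((square_series A * square_series B) (0 + 0 + m%:Z)).
rewrite [LHS](@lmul_coefE _ _ _ 0 0 m m.+1) //.
rewrite (@coefM_eq _ m.+1 _ (\sum_(x <- box m | A x) 'X^(absz x ^ 2)) _
  (\sum_(x <- box m | B x) 'X^(absz x ^ 2))) //; first last.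
- by move=> k km; rewrite coef_poly km add0r (@square_series_coef _ m).
- by move=> k km; rewrite coef_poly km add0r (@square_series_coef _ m).
rewrite big_distrlr /= -big_filter.
under eq_bigr do rewrite -big_filter.
set sA := filter _ _; set sB := filter _ _.
rewrite -(@big_allpairs _ _ _ _ _ sA sB
  (fun p => 'X^(absz p.1 ^ 2) * 'X^(absz p.2 ^ 2))).
rewrite coef_sum.
rewrite (eq_bigr
    (fun p => if m == (absz p.1 ^ 2 + absz p.2 ^ 2)%N then 1 else 0));
  last by move=> p _; rewrite -exprD coefXn; case: eqP.
rewrite -big_mkcond /= -big_filter fsbig_seq; last first.
  apply/filter_uniq/allpairs_uniq; rewrite ?filter_uniq ?box_uniq //.
  by move=> -[? ?] [].
apply: eq_fsbigl; apply/seteqP; split=> -[x y] /=; rewrite mem_filter /=.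
  move=> /andP[/eqP xym /allpairsP[[x' y'] /= [xA yB [xE yE]]]].
  move: xA yB xym; rewrite !mem_filter -xE -yE.
  by move=> /andP[-> _] /andP[-> _] /=; lia.
move=> /and3P[Ax By /eqP xym]; apply/andP; split; first by apply/eqP; lia.
by apply: allpairs_f; rewrite mem_filter ?Ax ?By mem_box_sqr //; nia.
Qed.

Lemma finite_sum_squares (P : pred (int * int)) (m : int) :
  finite_set [set p : int * int | P p && (p.1 ^+ 2 + p.2 ^+ 2 == m)].
Proof.
set s := [seq (x, y) | x <- box (absz m), y <- box (absz m)].
apply: (sub_finite_set (B := [set` s])); last exact: finite_seq.
move=> [x y] /= /andP[_ /eqP xym]; suff: (x, y) \in s by [].
by apply: allpairs_f; apply: mem_box_sqr; nia.
Qed.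

Lemma finite_sqr (P : pred int) (m : int) :
  finite_set [set n : int | P n && (n ^+ 2 == m)].
Proof.
apply: (sub_finite_set (B := [set` box (absz m)])); last exact: finite_seq.
by move=> x /= /andP[_ /eqP xym]; apply: mem_box_sqr; nia.
Qed.

Lemma square_series_split (A P : pred int) : square_series A =
  square_series (fun n => A n && P n) + square_series (fun n => A n && ~~ P n).
Proof.
apply: laurentP => m; rewrite lcoefD !square_seriesE.
rewrite (fsbigID [set n | P n]); last exact: finite_sqr.
congr (_ + _); apply: eq_fsbigl; apply/seteqP; split=> n /=.
- by move=> [/andP[-> ->] ->].
- by move=> /andP[/andP[-> ->] ->].
- by move=> [/andP[-> ->] /negP ->].
- by move=> /andP[/andP[-> /negP ?] ->].
Qed.

(** Over F_2 the fourth power multiplies exponents by 4, and [4 * n ^+ 2 = (2 * n) ^+ 2]. *)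
Lemma square_series_exp4 A : square_series A ^+ 4 =
  square_series (fun n => (2 %| n)%Z && A (n %/ 2)%Z).
Proof.
apply: laurentP => m; rewrite -[4%N]/(2 * 2)%N exprM !lcoef_sqr !square_seriesE.
case: ifPn => [m2|m2]; last first.
  rewrite fsbig1 // => n /andP[/andP[/dvdzP[k ->] _] /eqP nm].
  by move: m2; rewrite -nm; lia.
case: ifPn => [m4|m4]; last first.
  rewrite fsbig1 // => n /andP[/andP[/dvdzP[k ->] _] /eqP nm].
  by move: m2 m4; rewrite -nm; lia.
apply/esym/(reindex_fsbig (fun n => 2 * n)); split=> /=.
- by move=> n /= /andP[An /eqP nm]; rewrite dvdz_mulr // mulKz // An /=; lia.
- by move=> x y _ _; lia.
- move=> n /= /andP[/andP[/dvdzP[k ->] Ak] /eqP nm].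
  exists k; last by rewrite mulrC.
  by move: Ak; rewrite mulzK // => -> /=; lia.
Qed.

(** * Relations between the series [theta i] *)

Definition odd_theta (i : int) := square_series
  (fun n => (n == 2 * i %[mod 9])%Z && ~~ (2 %| n)%Z).

Lemma theta_exp4 i : theta i ^+ 4 =
  square_series (fun n => (n == 2 * i %[mod 9])%Z && (2 %| n)%Z).
Proof.
rewrite thetaE square_series_exp4; congr square_series; apply/funext => n /=.
by apply/idP/idP; lia.
Qed.

Lemma theta_double i : theta (2 * i) = theta i ^+ 4 + odd_theta i.
Proof.
by rewrite theta_exp4 thetaE (square_series_split _ (fun n => 2 %| n)%Z).
Qed.

Lemma odd_theta_mul i j :
  odd_theta i * odd_theta j + theta i ^+ 4 * theta j ^+ 4 =
  (theta (i + j) * theta (i - j)) ^+ 2.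
Proof.
rewrite !theta_exp4 !thetaE; apply: laurentP => m.
rewrite [LHS]lcoefD.
rewrite [RHS]lcoef_sqr.
rewrite [X in X + _]square_seriesM.
rewrite [X in _ + X]square_seriesM.
rewrite [X in if _ then X else _]square_seriesM.

have parity (x y : int) : (2 %| x - y)%Z -> (2 %| x)%Z = (2 %| y)%Z.
  by move=> xy; apply/idP/idP; lia.
(* Of the pairs in [P], those with odd entries come from the first product on the left, those with
   even entries from the second. *)
pose P (p : int * int) := [&& (p.1 == 2 * i %[mod 9])%Z,
  (p.2 == 2 * j %[mod 9])%Z & (2 %| p.1 - p.2)%Z].
transitivity
  (\sum_(p \in [set p | P p && (p.1 ^+ 2 + p.2 ^+ 2 == m)]) (1 : 'F_2)).
  rewrite [RHS](fsbigID [set p | ~~ (2 %| p.1)%Z]);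
    last exact: (finite_sum_squares P m).
  congr (_ + _); apply: eq_fsbigl; apply/seteqP; split=> -[x y]; rewrite /P /=.
  - move=> /and3P[/andP[-> x2] /andP[-> y2] ->]; split; last by [].
    by move: x2 y2; clear; lia.
  - by move=> [/andP[/and3P[-> -> xy] ->] x2]; rewrite -(parity _ _ xy) x2.
  - move=> /and3P[/andP[-> x2] /andP[-> y2] ->]; split; last by rewrite x2.
    by move: x2 y2; clear; lia.
  - move=> [/andP[/and3P[-> -> xy] ->] /negP/negPn x2].
    by rewrite -(parity _ _ xy) x2.
(* For odd [m] there is no such pair, since entries of equal parity have an even sum of squares. For
   even [m] the pairs are [(u + v, u - v)] with [u = i + j] and [v = i - j] modulo 9, because 2 is
   invertible there, and the sum of squares is [2 * (u ^+ 2 + v ^+ 2)]. *)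
case: ifPn => m2; last first.
  rewrite fsbig1 // => -[x y] /andP[/and3P[/= _ _ xy] /eqP]; move: m2; nia.
apply: (reindex_fsbig (fun p => (p.1 + p.2, p.1 - p.2))); split=> /=.
- move=> [u v] /= /and3P[ui vj /eqP uv].
  apply/andP; split; last by apply/eqP; nia.
  by rewrite /P /=; lia.
- by move=> [u v] [u' v'] _ _ /= [uE vE]; congr pair; lia.
- move=> [x y] /= /andP[/and3P[/= xi yj xy] /eqP xym].
  exists ((x + y) %/ 2, (x - y) %/ 2)%Z => /=; last by congr pair; lia.
  have [k xE] : exists k, x = y + 2 * k by exists ((x - y) %/ 2)%Z; lia.
  rewrite {}xE in xi xy xym *.
  have -> : ((y + 2 * k + y) %/ 2 = y + k)%Z by lia.
  have -> : ((y + 2 * k - y) %/ 2 = k)%Z by lia.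
  by apply/and3P; split; [lia | lia | apply/eqP; nia].
Qed.

Lemma theta_rel i j :
  theta (2 * i) * theta (2 * j) + theta (2 * i) * theta j ^+ 4 +
  theta (2 * j) * theta i ^+ 4 = (theta (i + j) * theta (i - j)) ^+ 2.
Proof.
rewrite -odd_theta_mul !theta_double.
set x := odd_theta i; set y := odd_theta j; set z := theta i; set w := theta j.
transitivity (x * y + z ^+ 4 * w ^+ 4 + (z ^+ 4 * w ^+ 4 + z ^+ 4 * w ^+ 4) +
  (x * w ^+ 4 + x * w ^+ 4) + (z ^+ 4 * y + z ^+ 4 * y)); first by ring.
by rewrite !laurentF2_addxx !addr0.
Qed.

Lemma eq_theta i j : (i = j %[mod 9])%Z -> theta i = theta j.
Proof.
move=> ij; rewrite !thetaE; congr square_series.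
by apply/funext => n; rewrite ij.
Qed.

Lemma thetaN i : theta (- i) = theta i.
Proof.
rewrite !thetaE; apply: laurentP => m; rewrite !square_seriesE.
apply: (reindex_fsbig (fun n => - n)); split=> /=.
- by move=> n /= /andP[ni /eqP nm]; rewrite sqrrN nm eqxx andbT; lia.
- by move=> x y _ _; lia.
- move=> n /= /andP[ni /eqP nm]; exists (- n); last by rewrite opprK.
  by rewrite sqrrN nm eqxx andbT; lia.
Qed.

(** The case [(2 * k, k)] of [theta_rel]: the sum is [3 * k] and the difference [k]. *)
Lemma dbl_theta k : theta (4 * k) * theta (2 * k) + theta (4 * k) * theta k ^+ 4
  + theta (2 * k) ^+ 5 + theta k ^+ 2 * theta (3 * k) ^+ 2 = 0.
Proof.
have := theta_rel (2 * k) k; rewrite -exprS exprMn.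
have -> : 2 * (2 * k) = 4 * k by ring.
have -> : 2 * k + k = 3 * k by ring.
have -> : 2 * k - k = k by ring.
by rewrite [theta (3 * k) ^+ 2 * _]mulrC => ->; rewrite laurentF2_addxx.
Qed.

(** The case [(k, 3 * k)] of [theta_rel], where [6 * k = - (3 * k)] modulo 9. *)
Lemma three_theta k : theta (2 * k) * theta (3 * k)
  + theta (2 * k) * theta (3 * k) ^+ 4 + theta k ^+ 4 * theta (3 * k)
  + theta (4 * k) ^+ 2 * theta (2 * k) ^+ 2 = 0.
Proof.
have := theta_rel k (3 * k); rewrite exprMn.
have -> : k + 3 * k = 4 * k by ring.
have -> : k - 3 * k = - (2 * k) by ring.
rewrite thetaN (_ : theta (2 * (3 * k)) = theta (3 * k)); last first.
  by rewrite -thetaN; apply: eq_theta; lia.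
by rewrite [theta (3 * k) * _ ^+ 4]mulrC => ->; rewrite laurentF2_addxx.
Qed.

(** * The projections p_{q,j} *)

Definition supported (q j : nat) (f : laurent 'F_2) :=
  forall n : int, (n != j %[mod q])%Z -> f n = 0.

Lemma lproj_supported q j f : supported q j f -> lproj q j f = f.
Proof. by move=> fj; apply: laurentP => n /=; case: ifPn => // /fj. Qed.

(** As [p] divides [q], an exponent that is [j] modulo [q] is [i] modulo [p], so only [f i] can
    contribute. *)
Lemma lproj_sum q j (f : nat -> laurent 'F_2) p i : (0 < p)%N ->
  (forall k, supported p k (f k)) -> (p %| q)%N -> (i < p)%N ->
  j = i %[mod p] -> lproj q j (\sum_(k < p) f k) = lproj q j (f i).
Proof.
move=> p0 fk pq ip ji; apply: laurentP => n /=; case: ifPn => // /eqP nj.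
rewrite (bigD1 (Ordinal ip)) //=.
rewrite (_ : (\sum_(k < p | k != Ordinal ip) f k) n = 0) ?addr0 //.
elim/big_ind: _ => // [g h g0 h0|k ki]; first by rewrite lcoefD g0 h0 addr0.
apply: fk; apply: contra ki => /eqP nk; apply/eqP/val_inj => /=.
have /dvdnP[s qE] := pq.
have : (n = j %[mod p])%Z.
  apply/eqP; rewrite eqz_mod_dvd; apply: (@dvdz_trans q%:Z).
    by rewrite qE PoszM dvdz_mull.
  by rewrite -eqz_mod_dvd; apply/eqP.
rewrite nk !modz_nat => -[]; rewrite ji !modn_small //.
Qed.

(** Multiplication by [f] shifts residue classes modulo [q] by [j]. *)
Lemma lprojM q j k (f g : laurent 'F_2) : supported q j f ->
  lproj q (j + k) (f * g) = f * lproj q k g.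
Proof.
move=> fj; apply: laurentP => n; rewrite [RHS]lcoefM /=.
have fE (i : int) : f i * (if (n - i == k %[mod q])%Z then g (n - i) else 0) =
    if (n == (j + k)%N %[mod q])%Z then f i * g (n - i) else 0.
  have [ij|/fj ->] := boolP (i == j %[mod q])%Z; last by rewrite !mul0r if_same.
  rewrite (_ : (n - i == k %[mod q])%Z = (n == (j + k)%N %[mod q])%Z).
    by case: ifP; rewrite ?mulr0.
  rewrite !eqz_mod_dvd PoszD in ij *.
  by rewrite -(rpredDr _ ij); congr (_ %| _)%Z; ring.
under eq_fsbigr do rewrite fE.
by case: ifP => // _; rewrite fsbig1.
Qed.

Lemma lproj_sqr q j (f : laurent 'F_2) :
  lproj (2 * q) (2 * j) (f ^+ 2) = lproj q j f ^+ 2.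
Proof.
apply: laurentP => n; rewrite [RHS]lcoef_sqr.
transitivity
  (if (n == (2 * j)%N %[mod (2 * q)%N])%Z then (f ^+ 2) n else 0) => //.
rewrite lcoef_sqr /=.
have [/dvdzP[m ->]|n2] := boolP (2 %| n)%Z; last by rewrite if_same.
rewrite mulzK //; congr (if _ then _ else _).
by rewrite !eqz_mod_dvd !PoszM [m * 2]mulrC -mulrBr dvdz_mul2l.
Qed.

Lemma lproj_exp4 q j (f : laurent 'F_2) :
  lproj (4 * q) (4 * j) (f ^+ 4) = lproj q j f ^+ 4.
Proof.
by rewrite -[4%N]/(2 * 2)%N -!mulnA !exprM !lproj_sqr.
Qed.

Lemma supported_sqr f : supported 2 0 (f ^+ 2).
Proof. by move=> n n2; rewrite lcoef_sqr ifF //; apply/negbTE; lia. Qed.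

Lemma supported_exp4 f : supported 4 0 (f ^+ 4).
Proof.
move=> n n4; rewrite -[4%N]/(2 * 2)%N exprM !lcoef_sqr.
by case: ifPn => // n2; rewrite ifF //; apply/negbTE; lia.
Qed.

Lemma supportedM q i j f g : supported q i f -> supported q j g ->
  supported q (i + j) (f * g).
Proof.
move=> fi gj n nij; rewrite -(lproj_supported _ _ _ gj) -(lprojM _ _ _ _ _ fi).
by rewrite /= (negbTE nij).
Qed.

Lemma supportedX q f k : supported q 1 f -> supported q k (f ^+ k).
Proof.
move=> f1; elim: k => [|k IH].
  move=> n; rewrite expr0 lcoef1; have [->|//] := eqVneq n 0.
  by rewrite eqxx.
by rewrite exprS; apply: (supportedM _ 1 k _ _ f1).
Qed.

Lemma supported_dvd p q j f : (p %| q)%N -> supported q j f -> supported p j f.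
Proof.
move=> /dvdnP[s ->] fj n nj; apply: fj; apply: contra nj.
by rewrite !eqz_mod_dvd PoszM; apply: dvdz_trans; rewrite dvdz_mull.
Qed.

(** An odd square is 1 modulo 8. *)
Lemma supported_odd_theta i : supported 8 1 (odd_theta i).
Proof.
move=> m m1; rewrite square_seriesE fsbig1 // => n /andP[/andP[_ n2] /eqP nm].
have [k nE] : exists k, n = 2 * k + 1 by exists (n %/ 2)%Z; lia.
have [l kE] : exists l, k * (k + 1) = 2 * l.
  have [[l ->]|[l ->]] : (exists l, k = 2 * l) \/ (exists l, k = 2 * l + 1).
  - by have [k2|k2] := boolP (2 %| k)%Z; [left|right]; exists (k %/ 2)%Z; lia.
  - by exists (l * (2 * l + 1)); ring.
  - by exists ((2 * l + 1) * (l + 1)); ring.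
case/negP: m1; rewrite -nm nE.
rewrite (_ : _ ^+ 2 = 4 * (k * (k + 1)) + 1); last by ring.
by rewrite kE; lia.
Qed.

(** * Projections of 1/a *)

Lemma theta_ring_subring : subring_closed (mem theta_ring).
Proof.
split=> [|f g|f g]; rewrite ?inE.
- by move=> M [[M1 _ _] _]; have := M1; rewrite inE.
- move=> fS gS M [[M1 MB MM] MG]; have := MB f g; rewrite !inE.
  by apply; [apply: fS|apply: gS].
- move=> fS gS M [[M1 MB MM] MG]; have := MM f g; rewrite !inE.
  by apply; [apply: fS|apply: gS].
Qed.

Lemma theta_ringM f g : theta_ring f -> theta_ring g -> theta_ring (f * g).
Proof.
by have [_ _ SM] := theta_ring_subring; have := SM f g; rewrite !inE.
Qed.

Lemma theta_ringD f g : theta_ring f -> theta_ring g -> theta_ring (f + g).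
Proof.
have [_ SB _] := theta_ring_subring; have := SB f g.
by rewrite laurentF2_oppr !inE.
Qed.

Lemma theta_ringX f n : theta_ring f -> theta_ring (f ^+ n).
Proof.
move=> fS; elim: n => [|n IH]; last by rewrite exprS; apply: theta_ringM.
by have [S1 _ _] := theta_ring_subring; have := S1; rewrite inE.
Qed.

Lemma theta_ring_theta i j : j \in [:: 1; 2; 3; 4] ->
  (i = j %[mod 9])%Z \/ (i = - j %[mod 9])%Z -> theta_ring (theta i).
Proof.
move=> j4 ij; have -> : theta i = theta j.
  by case: ij => /eq_theta -> //; rewrite thetaN.
move=> M [_]; apply; move: j4; rewrite !inE.
by move=> /or4P[] /eqP ->; rewrite /=; tauto.
Qed.

Lemma laurentF2_ring :
  Ring_theory.ring_theory (0 : laurent 'F_2) 1 +%R *%R +%R id eq.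
Proof.
split; [exact: add0r|exact: addrC|exact: addrA|exact: mul1r|exact: mulrC
  |exact: mulrA|exact: mulrDl| by []|exact: laurentF2_addxx].
Qed.

(** * The three quotients as elements of S *)

Section Quotients.
Variables a b c d : laurent 'F_2.
Hypotheses (abc : a * b + a * c ^+ 4 + b ^+ 5 + c ^+ 2 * d ^+ 2 = 0)
  (bca : b * c + b * a ^+ 4 + c ^+ 5 + a ^+ 2 * d ^+ 2 = 0)
  (cab : c * a + c * b ^+ 4 + a ^+ 5 + b ^+ 2 * d ^+ 2 = 0)
  (abc3 : c * d + c * d ^+ 4 + a ^+ 4 * d + b ^+ 2 * c ^+ 2 = 0)
  (bca3 : a * d + a * d ^+ 4 + b ^+ 4 * d + c ^+ 2 * a ^+ 2 = 0)
  (cab3 : b * d + b * d ^+ 4 + c ^+ 4 * d + a ^+ 2 * b ^+ 2 = 0)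
  (a0 : a != 0) (c0 : c != 0) (d1 : 1 + d != 0).
Hypotheses (Sa : theta_ring a) (Sb : theta_ring b) (Sc : theta_ring c)
  (Sd : theta_ring d).

Let g := a^-1.
Let ag : a * g = 1. Proof. exact: divff. Qed.

(** The nonzero factors of [cubic_rel_multiple] cancel in the field. *)
Let abc0 :
  a ^+ 2 * b + b ^+ 2 * c + c ^+ 2 * a + d + d ^+ 2 + d ^+ 3 = 0.
Proof.
have := cubic_rel_multiple _ _ _ _ _ laurentF2_ring a b c d
  abc bca abc3 bca3 cab3.
by move=> /eqP; rewrite !mulf_eq0 (negPf a0) (negPf c0) (negPf d1) => /eqP.
Qed.

Ltac in_theta_ring := repeat first
  [assumption | apply: theta_ringD | apply: theta_ringM | apply: theta_ringX].

Let q2 : theta_ring ((a * b ^+ 2 + b ^+ 6) * g ^+ 2).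
Proof.
have -> : (a * b ^+ 2 + b ^+ 6) * g ^+ 2 =
  c + c * d + c * d ^+ 3 + b ^+ 2 * c ^+ 2 + a * c ^+ 3 + a ^+ 4.
  exact: (quotient2E _ _ _ _ _ laurentF2_ring a b c d).
by in_theta_ring.
Qed.

Let q1 : theta_ring (b ^+ 5 * g).
Proof.
have -> : b ^+ 5 * g =
  b + b * d ^+ 3 + c ^+ 4 * d + b ^+ 3 * c * d + a ^+ 3 * c * d.
  exact: (quotient1E _ _ _ _ _ laurentF2_ring a b c d).
by in_theta_ring.
Qed.

Let q3 : theta_ring ((a ^+ 2 * b ^+ 2 + a ^+ 2 * c ^+ 8 +
  a * b ^+ 5 * c ^+ 4 + b ^+ 10) * g ^+ 3).
Proof.
set q := (X in theta_ring X).
have -> : q = c + c * d + b ^+ 2 * c ^+ 2 + a * c ^+ 3 + a * b ^+ 3 + a ^+ 4 +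
  b ^+ 2 * c ^+ 2 * d ^+ 2 + c * d ^+ 6 + b * c ^+ 6 + b ^+ 4 * c ^+ 3 +
  b ^+ 7 + a * c ^+ 3 * d ^+ 3.
  exact: (quotient3E _ _ _ _ _ laurentF2_ring a b c d).
by in_theta_ring.
Qed.

(** * Splitting [1 / a] and [b ^+ 3 / a] by residues of the exponents *)

Variables o o' : laurent 'F_2.
Hypotheses (aE : a = b ^+ 4 + o) (bE : b = c ^+ 4 + o').
Hypotheses (o8 : supported 8 1 o) (o'8 : supported 8 1 o').

Let oE : o = a + b ^+ 4.
Proof. by rewrite aE addrAC laurentF2_addxx add0r. Qed.

Let o'E : o' = b + c ^+ 4.
Proof. by rewrite {1}bE addrAC laurentF2_addxx add0r. Qed.

Let So : theta_ring o. Proof. by rewrite oE; in_theta_ring. Qed.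

Let So' : theta_ring o'. Proof. by rewrite o'E; in_theta_ring. Qed.

Let gE : g = b ^+ 4 * g ^+ 2 + o * g ^+ 2.
Proof. by rewrite -mulrDl -aE expr2 mulrA ag mul1r. Qed.

(** In [gE] the first term has even exponents and the second odd ones. The same splitting,
    multiplied by [b ^+ 2], serves for [lproj2_1]. *)
Let lproj2_0 : lproj 2 0 g = b ^+ 4 * g ^+ 2.
Proof.
pose f k := o ^+ k * (b ^+ (2 - k.*2) * g) ^+ 2.
have sumE : g = \sum_(k < 2) f k.
  rewrite !big_ord_recl big_ord0 -[RHS]/(f 0%N + (f 1%N + 0)) /f /subn /=.
  by rewrite {1}gE; ring.
have f2 k : supported 2 k (f k).
  rewrite -[k in supported _ k]addn0; apply: supportedM (supported_sqr _).
  exact/supportedX/(supported_dvd 2 8).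
rewrite [X in lproj _ _ X]sumE (lproj_sum _ _ f 2 0) // lproj_supported //.
by rewrite /f /subn /=; ring.
Qed.

Let lproj2_1 : lproj 2 1 (b ^+ 2 * g) = o * b ^+ 2 * g ^+ 2.
Proof.
pose f k := o ^+ k * (b ^+ (3 - k.*2) * g) ^+ 2.
have sumE : b ^+ 2 * g = \sum_(k < 2) f k.
  rewrite !big_ord_recl big_ord0 -[RHS]/(f 0%N + (f 1%N + 0)) /f /subn /=.
  by rewrite {1}gE; ring.
have f2 k : supported 2 k (f k).
  rewrite -[k in supported _ k]addn0; apply: supportedM (supported_sqr _).
  exact/supportedX/(supported_dvd 2 8).
rewrite [X in lproj _ _ X]sumE (lproj_sum _ _ f 2 1) // lproj_supported //.
by rewrite /f /subn /=; ring.
Qed.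

Let cubeD (x y : laurent 'F_2) :
  (x + y) ^+ 3 = x ^+ 3 + x ^+ 2 * y + x * y ^+ 2 + y ^+ 3.
Proof.
transitivity (x ^+ 3 + x ^+ 2 * y + x * y ^+ 2 + y ^+ 3 +
  (x ^+ 2 * y + x ^+ 2 * y) + (x * y ^+ 2 + x * y ^+ 2)); first by ring.
by rewrite !laurentF2_addxx !addr0.
Qed.

Let g_cube : g = a ^+ 3 * g ^+ 4.
Proof. by rewrite -[4%N]/(3 + 1)%N exprD mulrA -exprMn ag expr1n mul1r. Qed.

(** The terms of [g = (b ^+ 4 + o) ^+ 3 * g ^+ 4]: all binomial coefficients of a cube are odd, so
    each [k < 4] occurs once, with exponents [k] modulo 4. *)
Let f4 k := o ^+ k * (b ^+ (3 - k) * g) ^+ 4.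

Let f4_supported k : supported 4 k (f4 k).
Proof.
rewrite -[k in supported _ k]addn0; apply: supportedM (supported_exp4 _).
exact/supportedX/(supported_dvd 4 8).
Qed.

Let g_sum4 : g = \sum_(k < 4) f4 k.
Proof.
rewrite !big_ord_recl big_ord0.
rewrite -[RHS]/(f4 0 + (f4 1 + (f4 2 + (f4 3 + 0)))) /f4 /subn /=.
by rewrite {1}g_cube {1}aE cubeD; ring.
Qed.

(* The terms of [b ^+ 3 * g = (c ^+ 4 + o') ^+ 3 * (b ^+ 4 + o) ^+ 3 * g ^+ 4];
   [h4 k] collects those whose exponents are [k] modulo 4. *)
Let t4 i j := o' ^+ i * o ^+ j * (c ^+ (3 - i) * b ^+ (3 - j) * g) ^+ 4.
Let h4 k :=
  t4 0 k + t4 1 ((k + 3) %% 4) + t4 2 ((k + 2) %% 4) + t4 3 ((k + 1) %% 4).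

Let t4_supported i j : supported 4 (i + j) (t4 i j).
Proof.
rewrite -[(i + j)%N]addn0; apply: supportedM (supported_exp4 _).
by apply: supportedM; apply/supportedX/(supported_dvd 4 8).
Qed.

Let h4_supported k : supported 4 k (h4 k).
Proof.
move=> n nk; rewrite /h4 !lcoefD !t4_supported ?addr0 //; apply: contra nk; lia.
Qed.

Let bg_sum4 : b ^+ 3 * g = \sum_(k < 4) h4 k.
Proof.
rewrite !big_ord_recl big_ord0.
rewrite -[RHS]/(h4 0 + (h4 1 + (h4 2 + (h4 3 + 0)))).
rewrite -[h4 0]/(t4 0 0 + t4 1 3 + t4 2 2 + t4 3 1).
rewrite -[h4 1]/(t4 0 1 + t4 1 0 + t4 2 3 + t4 3 2).
rewrite -[h4 2]/(t4 0 2 + t4 1 1 + t4 2 0 + t4 3 3).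
rewrite -[h4 3]/(t4 0 3 + t4 1 2 + t4 2 1 + t4 3 0).
rewrite /t4 /subn /= {1}g_cube {1}aE.
by rewrite {1}bE !cubeD; ring.
Qed.

Let u := (a * b ^+ 2 + b ^+ 6) * g ^+ 2.
Let v := (a ^+ 2 * b ^+ 2 + a ^+ 2 * c ^+ 8 + a * b ^+ 5 * c ^+ 4 + b ^+ 10) *
  g ^+ 3 + u ^+ 2 * (b ^+ 2 + b * c ^+ 4 + c ^+ 8).

Let Su : theta_ring u. Proof. exact: q2. Qed.

Let Sv : theta_ring v.
Proof. by apply: theta_ringD; [exact: q3|in_theta_ring]. Qed.

Let lproj4_1 : lproj 4 1 (b ^+ 3 * g) = c ^+ 4 * v + u ^+ 2 * o' ^+ 3.
Proof.
rewrite bg_sum4 (lproj_sum _ _ h4 4 1) // lproj_supported //.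
transitivity ((c ^+ 12 * (a + b ^+ 4) * b ^+ 8 + (b + c ^+ 4) * c ^+ 8 * b ^+ 12
  + (b + c ^+ 4) ^+ 2 * c ^+ 4 * (a + b ^+ 4) ^+ 3
  + (b + c ^+ 4) ^+ 3 * (a + b ^+ 4) ^+ 2 * b ^+ 4) * g ^+ 4).
  rewrite -[h4 1]/(t4 0 1 + t4 1 0 + t4 2 3 + t4 3 2) /t4 /subn /= oE o'E.
  by ring.
rewrite o'E; exact: (quotient4_1E _ _ _ _ _ laurentF2_ring a b c g ag).
Qed.

Let lproj4_2 : lproj 4 2 (b ^+ 3 * g) = o' * v + c ^+ 12 * u ^+ 2.
Proof.
rewrite bg_sum4 (lproj_sum _ _ h4 4 2) // lproj_supported //.
transitivity ((c ^+ 12 * (a + b ^+ 4) ^+ 2 * b ^+ 4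
  + (b + c ^+ 4) * c ^+ 8 * (a + b ^+ 4) * b ^+ 8
  + (b + c ^+ 4) ^+ 2 * c ^+ 4 * b ^+ 12
  + (b + c ^+ 4) ^+ 3 * (a + b ^+ 4) ^+ 3) * g ^+ 4).
  rewrite -[h4 2]/(t4 0 2 + t4 1 1 + t4 2 0 + t4 3 3) /t4 /subn /= oE o'E.
  by ring.
rewrite o'E; exact: (quotient4_2E _ _ _ _ _ laurentF2_ring a b c g ag).
Qed.

Lemma theta_ring_lproj_inv :
  [/\ theta_ring (lproj 4 2 g), theta_ring (lproj 8 3 g),
      theta_ring (lproj 8 5 g), theta_ring (lproj 16 4 g) &
      theta_ring (lproj 16 8 g)].
Proof.
have lprojE q i j (_ : (4 %| q)%N) (_ : (i < 4)%N) (_ : j = i %[mod 4]) :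
    lproj q j g = lproj q j (f4 i).
  by rewrite [X in lproj _ _ X = _]g_sum4 (lproj_sum _ _ f4 4 i).
split.
- rewrite (lprojE 4 2 2)%N // lproj_supported //.
  have -> : f4 2 = u ^+ 2 by rewrite /f4 /subn /= /u oE; ring.
  by in_theta_ring.
(* The factor [o ^+ 3] accounts for the residue 3 modulo 8, which leaves the projection of [g ^+ 4]
   to exponents 0 modulo 8, that is [lproj 2 0 g ^+ 4]. *)
- rewrite (lprojE 8 3 3)%N // -[f4 3]/(o ^+ 3 * (b ^+ 0 * g) ^+ 4) expr0 mul1r.
  rewrite (lprojM 8 3 0 _ _ (supportedX 8 o 3 o8)) (lproj_exp4 2 0) lproj2_0.
  have -> : o ^+ 3 * (b ^+ 4 * g ^+ 2) ^+ 4 = u ^+ 3 * (b ^+ 5 * g) ^+ 2.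
    by rewrite /u oE; ring.
  by in_theta_ring.
(* Here 5 = 1 + 4: the factor [o] takes 1, and the 4 becomes residue 1 modulo 2 for [b ^+ 2 * g]. *)
- rewrite (lprojE 8 1 5)%N // -[f4 1]/(o * (b ^+ 2 * g) ^+ 4).
  rewrite (lprojM 8 1 4 _ _ o8) (lproj_exp4 2 1) lproj2_1.
  have -> : o * b ^+ 2 * g ^+ 2 = u by rewrite /u oE; ring.
  by in_theta_ring.
(* Since [f4 0] is the fourth power of [b ^+ 3 * g], residues 4 and 8 modulo 16 become 1 and 2
   modulo 4. *)
- rewrite (lprojE 16 0 4)%N // -[f4 0]/(1 * (b ^+ 3 * g) ^+ 4) mul1r.
  by rewrite (lproj_exp4 4 1) lproj4_1; in_theta_ring.
- rewrite (lprojE 16 0 8)%N // -[f4 0]/(1 * (b ^+ 3 * g) ^+ 4) mul1r.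
  by rewrite (lproj_exp4 4 2) lproj4_2; in_theta_ring.
Qed.
End Quotients.

Theorem theorem6p1 (r : int) (hr : r \in [:: 1; 2; 4]) (a : laurent 'F_2)
    (ha : a = theta r) :
  [/\ theta_ring (lproj 4 2 (1 / a)),
      theta_ring (lproj 8 3 (1 / a)),
      theta_ring (lproj 8 5 (1 / a)),
      theta_ring (lproj 16 4 (1 / a)) &
      theta_ring (lproj 16 8 (1 / a))].
Proof.
(* 7 is the inverse of 4 modulo 9. *)
rewrite mul1r ha; pose k := 7 * r.
have E1 : theta r = theta (4 * k) by apply: eq_theta; rewrite /k; lia.
have E2 : 2 * (2 * k) = 4 * k by ring.
have E3 : theta (3 * (2 * k)) = theta (3 * k).
  by rewrite -thetaN; apply: eq_theta; lia.
have E4 : theta (4 * (2 * k)) = theta k by rewrite -thetaN; apply: eq_theta; lia.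
have E5 : theta (2 * (4 * k)) = theta k by rewrite -thetaN; apply: eq_theta; lia.
have E6 : theta (3 * (4 * k)) = theta (3 * k) by apply: eq_theta; lia.
have E7 : theta (4 * (4 * k)) = theta (2 * k).
  by rewrite -thetaN; apply: eq_theta; lia.
have [abc cab3] := (dbl_theta k, three_theta k).
(* Up to sign modulo 9, doubling [k] permutes [4 * k], [2 * k], [k] cyclically and fixes [3 * k];
   this yields the other four relations. *)
have := three_theta (2 * k); have := dbl_theta (2 * k).
have := three_theta (4 * k); have := dbl_theta (4 * k).
rewrite E2 E3 E4 E5 E6 E7 => bca abc3 cab bca3.
have oE := theta_double (2 * k); rewrite E2 in oE.
have nz i : i \in [:: 1; 2; 4] -> theta i != 0 by exact: theta_neq0.
(* For [r] = 1, 2, 4 the residue of [k] modulo 9 is -2, -4, 1. *)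
have c0 : theta k != 0.
  move: hr; rewrite /k !inE => /or3P[] /eqP ->.
  - by rewrite (eq_theta _ (- 2)) // thetaN nz.
  - by rewrite (eq_theta _ (- 4)) // thetaN nz.
  - by rewrite (eq_theta _ 1) // nz.
(* The constant term is 1, because 9 does not divide [3 * k] and so [theta (3 * k)] has no constant
   term. *)
have d1 : 1 + theta (3 * k) != 0.
  apply/eqP => /(congr1 (fun f : laurent 'F_2 => f 0)); rewrite lcoefD lcoef1.
  rewrite thetaE square_seriesE fsbig1 ?addr0 => [/eqP|n /andP[n3 /eqP n0]].
    by rewrite oner_eq0.
  move: hr n3; have {n0} -> : n = 0 by apply/eqP; rewrite -sqrf_eq0 n0.
  by rewrite /k !inE => /or3P[] /eqP ->.
have S i j := theta_ring_theta i j.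
have [Sa Sb Sc Sd] : [/\ theta_ring (theta (4 * k)), theta_ring (theta (2 * k)),
    theta_ring (theta k) & theta_ring (theta (3 * k))].
  move: hr; rewrite /k !inE => /or3P[] /eqP ->.
  - by split; [apply: (S _ 1)|apply: (S _ 4)|apply: (S _ 2)|apply: (S _ 3)];
      rewrite //; lia.
  - by split; [apply: (S _ 2)|apply: (S _ 1)|apply: (S _ 4)|apply: (S _ 3)];
      rewrite //; lia.
  - by split; [apply: (S _ 4)|apply: (S _ 2)|apply: (S _ 1)|apply: (S _ 3)];
      rewrite //; lia.
rewrite E1; apply: (theta_ring_lproj_inv _ _ _ _ abc bca cab abc3 bca3 cab3 _ c0 d1
  Sa Sb Sc Sd _ _ oE (theta_double k)); try exact: supported_odd_theta.
by rewrite -E1 nz.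
Qed.
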